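(* Let $n\ge 3$ be an integer, let $\mathcal{D}_{2n}$ be the dihedral group of order $2n$, and let $\rho_1(\mathcal{P}(\mathcal{D}_{2n}))$ be the distance spectral radius of its power graph. Let $T_{avg}$ and $T_{max}$ be, respectively, the average and the maximum transmission of the power graph $\mathcal{P}(C_n)$ of the cyclic group $C_n$ of order $n$. Then $$\rho_{1}(\mathcal{P}(\mathcal{D}_{2n}))\ge \frac{1}{2}\left[(T_{avg}+2n-2) + \sqrt{(T_{avg}-2n+2)^{2}+4(2n-1)^{2}}\right]$$ and $$\rho_{1}(\mathcal{P}(\mathcal{D}_{2n}))\le \frac{1}{2}\left[(T_{max}+2n-2) + \sqrt{(T_{max}-2n+2)^{2}+8n(2n-1)}\right].$$
   Context: The power graph $\mathcal{P}(\mathbb{G})$ of a finite group $\mathbb{G}$ is the simple undirected graph with vertex set $\mathbb{G}$ in which two distinct elements $x,y$ are adjacent if and only if one of them is an integral power of the other; it is always connected. The dihedral group is $\mathcal{D}_{2n}=\langle a,b \mid a^n=e,\ b^2=e,\ ba=a^{-1}b\rangle$, of order $2n$. For a connected graph $G$ with vertices $v_1,\dots,v_N$, the distance matrix is $D(G)=(d_{ij})$ with $d_{ij}$ the length of a shortest path between $v_i$ and $v_j$; the distance spectral radius $\rho_1(G)$ is the largest eigenvalue of $D(G)$; the transmission of $v_i$ is $\operatorname{Tr}(v_i)=\sum_{j=1}^N d_{ij}$; the average and maximum transmissions of $G$ are the mean and the maximum of $\operatorname{Tr}(v_i)$ over all vertices of $G$. *)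

(* Defs.v *)
From HB Require Import structures.
From mathcomp Require Import all_boot all_order all_algebra all_fingroup all_solvable.
From mathcomp Require Import classical_sets reals.
From mathcomp Require complex.

Set Implicit Arguments.
Unset Strict Implicit.
Unset Printing Implicit Defensive.

Import Order.TTheory GRing.Theory Num.Theory.
Local Open Scope ring_scope.

Section GraphDistance.
Variables (T : finType) (e : rel T).

(* A shortest path in a connected graph on T has fewer than #|T| edges, so the
   bounds on k lose nothing; #|T| is the value for disconnected vertices. *)
Definition gdist (x y : T) : nat :=
  \big[minn/#|T|]_(k < #|T| |
     [exists p : k.-tuple T, path e x p && (last x p == y)]) k.

Definition transmission (x : T) : nat := \sum_(y : T) gdist x y.

Definition max_transmission : nat := \max_(x : T) transmission x.

Definition avg_transmission (R : realType) : R :=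
  (\sum_(x : T) transmission x)%:R / #|T|%:R.

Definition distance_matrix (R : realType) : 'M[R]_#|T| :=
  \matrix_(i, j) (gdist (enum_val i) (enum_val j))%:R.

Lemma gdist_min x p : path e x p -> (gdist x (last x p) <= size p)%N.
Proof.
move=> ep; have [Tp|pT] := leqP #|T| (size p).
  apply: leq_trans Tp; rewrite /gdist.
  by elim/big_ind: _ => [//|a b aT _|i _]; [rewrite geq_min aT | exact: ltnW].
have Pk : [exists q : (size p).-tuple T, path e x q && (last x q == last x p)].
  by apply/existsP; exists (in_tuple p); rewrite /= ep eqxx.
exact: (@bigmin_le_cond _ nat _ #|T| (Ordinal pT) _ (@nat_of_ord #|T|) Pk).
Qed.

Lemma gdist_path x y : connect e x y ->
  exists p, [/\ path e x p, last x p = y & size p = gdist x y].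
Proof.
case/connectP => p0 ep0 ->{y}; case/shortenP: ep0 => p ep up _ {p0}.
have pT : (size p < #|T|)%N.
  by rewrite -[(size p).+1]/(size (x :: p)) -(card_uniqP up) max_card.
have := gdist_min ep; set y := last x p.
suff: gdist x y = #|T| \/ exists q, [/\ path e x q, last x q = y & size q = gdist x y].
  by case=> [->|//]; rewrite leqNgt pT.
rewrite /gdist; elim/big_ind: _ => [|a b [->|[q qP]] [->|[r rP]]|k].
- by left.
- by left; rewrite minnn.
- by rewrite /minn; case: ifP => _; [left | right; exists r].
- by rewrite /minn; case: ifP => _; [right; exists q | left].
- by rewrite /minn; case: ifP => _; right; [exists q | exists r].
- case/existsP=> q /andP[eq /eqP lq]; right; exists q.
  by rewrite size_tuple.
Qed.

Lemma gdist_sym : symmetric e -> (forall x y, connect e x y) ->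
  forall x y, gdist x y = gdist y x.
Proof.
move=> syme conn.
suff le_gdist x y : (gdist x y <= gdist y x)%N.
  by move=> x y; apply/eqP; rewrite eqn_leq !le_gdist.
have [p [ep <- <-]] := gdist_path (conn y x).
have := rev_path e y p; rewrite (eq_path (e' := e)) => [|? ?]; last exact: syme.
rewrite ep => /gdist_min; rewrite size_rev size_belast.
by case: p {ep} => //= z p; rewrite rev_cons last_rcons.
Qed.

End GraphDistance.

(* mathcomp's [eigenvalue] refers to row eigenvectors, which for a square
   matrix gives the same eigenvalues as column eigenvectors. *)
Definition is_largest_eigenvalue (R : realType) n (A : 'M[R]_n) (a : R) : Prop :=
  eigenvalue A a /\ forall b, eigenvalue A b -> b <= a.

(* The default 0 only serves matrices without real eigenvalues: see
   [largest_eigenvalueP] for symmetric ones. *)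
Definition largest_eigenvalue (R : realType) n (A : 'M[R]_n) : R :=
  xget 0 [set a : R | is_largest_eigenvalue A a]%classic.

Section LargestEigenvalue.
Import complex.

Lemma largest_eigenvalueP (R : realType) n (A : 'M[R]_n) :
  (0 < n)%N -> A^T = A -> is_largest_eigenvalue A (largest_eigenvalue A).
Proof.
case: n A => // n A _ symA; apply: xgetPex.
pose toC := real_complex R; pose B := map_mx toC A.
have hB : B \is hermsymmx.
  apply: realsym_hermsym.
    by apply/is_hermitianmxP; rewrite expr0 scale1r map_mx_id // /B map_trmx symA.
  by apply/mxOverP => i j; rewrite mxE; apply/complex_realP; exists (A i j).
have eqB : B = invmx (spectralmx B) *m diag_mx (spectral_diag B) *m spectralmx B.
  exact/orthomx_spectralP/hermitian_normalmx.
have dreal := hermitian_spectral_diag_real hB.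
set P := spectralmx B in eqB; set d := spectral_diag B in eqB dreal.
have uP : P \in unitmx := spectral_unit B.
have PB : P *m B = diag_mx d *m P by rewrite eqB !mulmxA mulmxV // mul1mx.
have dE i : exists r, d 0 i = toC r.
  by apply/complex_realP; move/mxOverP: dreal.
have eigB r : eigenvalue A r = eigenvalue B (toC r).
  by rewrite !eigenvalue_root_char /B -map_char_poly fmorph_root.
pose m (i : 'I_n.+1) := complex.Re (d 0 i).
have mE i : toC (m i) = d 0 i by rewrite /m; have [r ->] := dE i.
have [i0 _ maxm] := @Order.TotalTheory.arg_maxP _ _ 'I_n.+1 ord0 xpredT m isT.
exists (m i0); split=> [|b].
  rewrite eigB mE; apply/eigenvalueP; exists (row i0 P).
    by rewrite -row_mul PB row_mul row_diag_mx -scalemxAl -rowE.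
  apply: contraTneq uP => P0; rewrite -row_free_unit; apply/negP => /row_freeP[Q PQ].
  have := congr1 (row i0) PQ; rewrite row_mul P0 mul0mx => /matrixP/(_ 0 i0).
  by rewrite !mxE eqxx => /esym/eqP; rewrite oner_eq0.
rewrite eigB => /eigenvalueP[v vB v0].
pose w := v *m invmx P.
have wP : w *m P = v by rewrite /w -mulmxA mulVmx // mulmx1.
have wD : w *m diag_mx d = toC b *: w.
  by rewrite /w scalemxAl -vB eqB !mulmxA mulmxK.
have /rV0Pn[j wj] : w != 0.
  by apply: contra_neq v0 => w0; rewrite -wP w0 mul0mx.
have := congr1 (fun u : 'rV_n.+1 => u 0 j) wD.
rewrite mul_mx_diag mxE [RHS]mxE mulrC => /mulIf-/(_ wj).
rewrite -mE => /complexI mj.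
by rewrite -mj; exact: maxm.
Qed.

End LargestEigenvalue.

Definition distance_spectral_radius (R : realType) (T : finType) (e : rel T) : R :=
  largest_eigenvalue (distance_matrix e R).

(* <[y]> is the set of integral powers of y; when the group is written
   additively, as 'Z_n, these are the integral multiples of y. *)
Definition power_graph (gT : finGroupType) : rel gT :=
  fun x y => (x != y) && ((x \in <[y]>%g) || (y \in <[x]>%g)).
Arguments power_graph : clear implicits.

Lemma power_graph_sym (gT : finGroupType) : symmetric (power_graph gT).
Proof. by move=> x y; rewrite /power_graph eq_sym orbC. Qed.

Lemma power_graph_connected (gT : finGroupType) (x y : gT) :
  connect (power_graph gT) x y.
Proof.
have c1 z : connect (power_graph gT) z 1%g.
  have [->|z1] := eqVneq z 1%g; first exact: connect0.
  by apply: connect1; rewrite /power_graph z1 group1 orbT.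
apply: connect_trans (c1 x) _.
by rewrite (sym_connect_sym (@power_graph_sym gT)).
Qed.

Lemma power_graph_spectral_radiusP (R : realType) (gT : finGroupType) :
  is_largest_eigenvalue (distance_matrix (power_graph gT) R)
    (distance_spectral_radius R (power_graph gT)).
Proof.
apply: largest_eigenvalueP; first by apply/card_gt0P; exists 1%g.
apply/matrixP => i j; rewrite !mxE gdist_sym //.
  exact: power_graph_sym.
exact: power_graph_connected.
Qed.

(* Main.v *)
Require Import Defs.
From HB Require Import structures.
From mathcomp Require Import all_boot all_order all_algebra all_fingroup all_solvable.
From mathcomp Require Import classical_sets reals.
From mathcomp Require complex.
From mathcomp Require Import zify ring lra.

Set Implicit Arguments.
Unset Strict Implicit.
Unset Printing Implicit Defensive.

Import Order.TTheory GRing.Theory Num.Theory.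
Local Open Scope ring_scope.

(** The rotations form a cyclic subgroup H of order n in the dihedral group,
    and each reflection y generates the subgroup of order 2 with elements 1
    and y.  A power graph has diameter at most 2 because 1 is adjacent to
    everything, so its distances are 0, 1 or 2 according to adjacency alone.
    Hence the distances inside H are those of the power graph of C_n, while a
    reflection is at distance 1 from the identity and 2 from every other
    vertex.  In blocks (rotations, reflections), the row sums of the distance
    matrix D are therefore
    - Tr(x), and n or 2n (n only for x = 1), in the row of a rotation x;
    - 2n - 1, and 2n - 2, in the row of a reflection.

    Now let D act on vectors that are constant on each block.

    For the upper bound, replace Tr(x) by Tmax and the entry n by 2n.  The
    2 x 2 matrix with rows (Tmax, 2n) and (2n - 1, 2n - 2) has as its larger
    eigenvalue mu the stated bound, with positive eigenvector
    (2n, mu - Tmax).  The corresponding block vector w satisfies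
    D w <= mu w entrywise, and such a positive vector bounds all eigenvalues
    of a nonnegative matrix by mu ([eigenvalue_le_weight]).

    For the lower bound, average over each block: the Rayleigh quotient of D
    at a block vector is that of the symmetric 2 x 2 matrix with rows
    (Tavg, 2n - 1) and (2n - 1, 2n - 2).  At the eigenvector
    (2n - 1, mu - Tavg) it equals the larger eigenvalue mu, the stated bound,
    and a Rayleigh quotient never exceeds the largest eigenvalue of a symmetric
    matrix ([rayleigh_le]). *)

(** * Bounds on the eigenvalues of a real matrix *)

(** A weighted triangle inequality: if v is a left eigenvector for b, then
    pairing |v| with A w bounds b <|v|, w> by <|v|, A w>, hence by
    mu <|v|, w>, and <|v|, w> is positive. *)
Lemma eigenvalue_le_weight (R : realType) n (A : 'M[R]_n) (w : 'I_n -> R) (mu : R) :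
    (forall i j, 0 <= A i j) -> (forall i, 0 < w i) ->
    (forall i, \sum_j A i j * w j <= mu * w i) ->
  forall b, eigenvalue A b -> b <= mu.
Proof.
move=> A0 w0 Aw b /eigenvalueP[v vA /rV0Pn[k vk]].
have vE j : b * v 0 j = \sum_i v 0 i * A i j.
  by have /rowP/(_ j) := vA; rewrite !mxE => <-.
have S0 : 0 < \sum_j `|v 0 j| * w j.
  rewrite (bigD1 k) //= ltr_wpDr ?mulr_gt0 ?normr_gt0 //.
  by apply: sumr_ge0 => j _; rewrite mulr_ge0 // ltW.
rewrite -(ler_pM2r S0) mulr_sumr.
apply: (@le_trans _ _ (\sum_j (\sum_i `|v 0 i| * A i j) * w j)).
  apply: ler_sum => j _; rewrite mulrA; apply: ler_wpM2r; first exact: ltW.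
  apply: (@le_trans _ _ `|b * v 0 j|).
    by rewrite normrM ler_wpM2r ?ler_norm.
  rewrite vE; apply: le_trans (ler_norm_sum _ _ _) _.
  by apply: ler_sum => i _; rewrite normrM (ger0_norm (A0 _ _)).
under eq_bigr do rewrite mulr_suml.
rewrite exchange_big mulr_sumr; apply: ler_sum => i _ /=.
rewrite (eq_bigr (fun j => `|v 0 i| * (A i j * w j))) => [|j _]; last by rewrite mulrA.
by rewrite -mulr_sumr mulrCA ler_wpM2l.
Qed.

Section Rayleigh.
Import complex.
Local Open Scope sesquilinear_scope.

(** Over the complex numbers A is unitarily diagonalizable.  In an orthonormal
    eigenbasis the quadratic form of A is the sum of the d_i |u_i|^2, where the
    d_i are real eigenvalues of A and the sum of the |u_i|^2 is the squared
    norm of x. *)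
Lemma rayleigh_le (R : realType) n (A : 'M[R]_n) (rho : R) (x : 'I_n -> R) :
    A^T = A -> (forall b, eigenvalue A b -> b <= rho) ->
  \sum_i x i * (\sum_j A i j * x j) <= rho * \sum_i x i ^+ 2.
Proof.
move=> symA maxrho; pose toC := real_complex R; pose B := map_mx toC A.
have hB : B \is hermsymmx.
  apply: realsym_hermsym.
    by apply/is_hermitianmxP; rewrite expr0 scale1r map_mx_id // /B map_trmx symA.
  by apply/mxOverP => i j; rewrite mxE; apply/complex_realP; exists (A i j).
have /(orthomx_spectralP (A := B)) eqB := hermitian_normalmx hB.
have dreal := hermitian_spectral_diag_real hB.
have uP := spectral_unitarymx B.
set P := spectralmx B in eqB uP; set d := spectral_diag B in eqB dreal.
rewrite (invmx_unitary uP) in eqB.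
have PPt : P *m P ^t* = 1%:M by apply/unitarymxP.
have PtP : P ^t* *m P = 1%:M by rewrite -(invmx_unitary uP) mulVmx // unitarymx_unit.
have PB : P *m B = diag_mx d *m P by rewrite eqB !mulmxA PPt mul1mx.
have d_le i : d 0 i <= toC rho.
  have /complex_realP[r dr] : d 0 i \is Num.real by move/mxOverP: dreal.
  rewrite dr lecR; apply: maxrho.
  rewrite eigenvalue_root_char -(fmorph_root toC) map_char_poly.
  rewrite -eigenvalue_root_char -[map_mx _ _]/B.
  apply/eigenvalueP; exists (row i P).
    by rewrite -row_mul PB row_mul row_diag_mx -scalemxAl -rowE dr.
  apply: contra_eqN PPt => /eqP P0; apply/negP => /eqP /matrixP/(_ i i).
  rewrite !mxE eqxx big1 => [/esym/eqP|j _]; first by rewrite oner_eq0.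
  by have /rowP/(_ j) := P0; rewrite !mxE => ->; rewrite mul0r.
pose w : 'rV_n := \row_i toC (x i).
have wt : w ^t* = w^T.
  by apply/colP => i; rewrite !mxE; apply: conj_Creal; apply/complex_realP; exists (x i).
pose u := w *m P ^t*.
have uw : u *m P = w by rewrite /u -mulmxA PtP mulmx1.
have ut : u ^t* = P *m w^T.
  by rewrite /u trmx_mul map_mxM /= wt map_trmx trmxK -map_mx_comp map_mx_id //= => z; exact: conjCK.
have formE : w *m B *m w^T = u *m diag_mx d *m u ^t*.
  by rewrite eqB ut /u !mulmxA.
have normE : w *m w^T = u *m u ^t*.
  by rewrite ut /u mulmxA -(mulmxA w) PtP mulmx1.
rewrite -lecR rmorphM /=.
have -> : (\sum_i x i * (\sum_j A i j * x j))%:C%C = (w *m B *m w^T) 0 0.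
  rewrite -mulmxA !mxE rmorph_sum; apply: eq_bigr => i _.
  rewrite rmorphM !mxE rmorph_sum; congr (_ * _); apply: eq_bigr => j _.
  by rewrite rmorphM !mxE.
have -> : (\sum_i x i ^+ 2)%:C%C = (w *m w^T) 0 0.
  by rewrite !mxE rmorph_sum; apply: eq_bigr => i _; rewrite rmorphXn !mxE.
rewrite formE normE mul_mx_diag !mxE mulr_sumr; apply: ler_sum => i _.
rewrite !mxE mulrAC (mulrC _ (d 0 i)); apply: ler_wpM2r => //.
exact: mul_conjC_ge0.
Qed.
End Rayleigh.

(** The larger root mu of the characteristic equation of a 2 x 2 matrix with
    diagonal (t, d) and off-diagonal product p > 0.  As mu exceeds t, block
    vectors with second entry mu - t are positive. *)
Lemma quadratic_root (R : realType) (t d p : R) (mu := 2^-1 * (t + d + Num.sqrt ((t - d) ^+ 2 + 4 * p))) :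
  0 < p -> t < mu /\ (mu - t) * (mu - d) = p.
Proof.
move=> p0; set s := Num.sqrt _ in mu *.
have s2 : s ^+ 2 = (t - d) ^+ 2 + 4 * p by rewrite sqr_sqrtr //; have := sqr_ge0 (t - d); lra.
have s0 : 0 <= s by exact: sqrtr_ge0.
split; rewrite /mu; last by field: s2.
suff : t - d < s by lra.
have [|lt0] := ltP (t - d) 0; first by move/lt_le_trans; apply.
by rewrite -(ltr_pXn2r (n := 2)) // ?s2; lra.
Qed.

(** * Distances in power graphs *)

(** The identity is adjacent to every other vertex, so two distinct vertices
    that are not adjacent are joined by a path of length 2 through 1. *)
Lemma gdist_power_graph (gT : finGroupType) (x y : gT) :
  gdist (power_graph gT) x y
    = if x == y then 0%N else if power_graph gT x y then 1%N else 2%N.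
Proof.
set e := power_graph gT; have e_sym : symmetric e by exact: power_graph_sym.
have d_gt0 : x != y -> (0 < gdist e x y)%N.
  move=> xy; have [p [_ py <-]] := gdist_path (power_graph_connected x y).
  by case: p py xy => //= ->; rewrite eqxx.
have [<-|xy] := eqVneq x y.
  by apply/eqP; rewrite -leqn0; exact: (@gdist_min _ e x [::]).
have [exy|nexy] := boolP (e x y).
  apply/eqP; rewrite eqn_leq d_gt0 // andbT.
  by apply: (@gdist_min _ e x [:: y]); rewrite /= exy.
have e1 z : z != 1%g -> e z 1%g by rewrite /e /power_graph => ->; rewrite group1 orbT.
have x1 : x != 1%g.
  by apply: contraNneq nexy => x1; rewrite e_sym x1 e1 // -x1 eq_sym.
have y1 : y != 1%g by apply: contraNneq nexy => ->; exact: e1.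
apply/eqP; rewrite eqn_leq; apply/andP; split.
  apply: (@gdist_min _ e x [:: 1%g; y]) => /=.
  by rewrite e1 //= e_sym e1.
have := d_gt0 xy.
have [p [ep py <-]] := gdist_path (power_graph_connected x y).
by case: p ep py nexy => [|z [|? ?]] //=; rewrite andbT => exz <-; rewrite /e exz.
Qed.

Lemma power_graph_injm (aT rT : finGroupType) (G : {group aT})
    (f : {morphism G >-> rT}) (x y : aT) :
    ('injm f)%g -> x \in G -> y \in G ->
  power_graph rT (f x) (f y) = power_graph aT x y.
Proof.
move=> injf Gx Gy; rewrite /power_graph (inj_in_eq (injmP injf)) //.
have powE u v : u \in G -> v \in G -> (f u \in <[f v]>%g) = (u \in <[v]>%g).
  move=> Gu Gv; rewrite -!cycle_subG /= -!morphim_cycle //.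
  by rewrite injmSK // cycle_subG.
by rewrite !powE.
Qed.

Lemma sum_cycle (gT : finGroupType) (x : gT) (V : nmodType) (F : gT -> V) :
  (1 < #[x]%g)%N ->
  \sum_(y in <[x]>%g) F y = \sum_(i : 'Z_(#[x]%g)) F (Zpm i).
Proof.
move=> ox; have ZpT : Zp #[x]%g = [set: 'Z_(#[x]%g)]%g by rewrite /Zp ox.
rewrite -im_Zpm morphimEdom /= ZpT big_imset /=; last first.
  by rewrite -ZpT; exact/injmP/injm_Zpm.
by apply: eq_bigl => i; rewrite inE.
Qed.

(** The power graph of a cyclic subgroup is an induced subgraph, and distances
    depend on adjacency only: they can be measured in [gT] or in 'Z_#[x]. *)
Lemma sum_gdist_cycle (gT : finGroupType) (x : gT) (i : 'Z_(#[x]%g)) :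
    (1 < #[x]%g)%N ->
  (\sum_(y in <[x]>%g) gdist (power_graph gT) (Zpm i) y)%N
    = transmission (power_graph 'Z_#[x]%g) i.
Proof.
move=> ox; rewrite sum_cycle //; apply: eq_bigr => j _.
have inZ k : k \in Zp #[x]%g by rewrite /Zp ox inE.
rewrite !gdist_power_graph (power_graph_injm (injm_Zpm x)) //.
by rewrite (inj_in_eq (injmP (injm_Zpm x))).
Qed.

Lemma avg_transmission_cycle (R : realType) (gT : finGroupType) (x : gT) (n : nat) :
    (1 < n)%N -> #[x]%g = n ->
  (\sum_(y in <[x]>%g) \sum_(z in <[x]>%g) gdist (power_graph gT) y z)%N%:R
    = n%:R * avg_transmission (power_graph 'Z_n) R.
Proof.
move=> n_gt1 ox; subst n; rewrite sum_cycle // /avg_transmission.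
rewrite card_ord [in X in _ / X]Zp_cast // mulrC divfK; last first.
  by rewrite pnatr_eq0 -lt0n; exact: ltnW.
by congr _%:R; apply: eq_bigr => i _; exact: sum_gdist_cycle.
Qed.

Lemma le_max_transmission_cycle (gT : finGroupType) (x y : gT) (n : nat) :
    (1 < n)%N -> #[x]%g = n -> y \in <[x]>%g ->
  (\sum_(z in <[x]>%g) gdist (power_graph gT) y z
     <= max_transmission (power_graph 'Z_n))%N.
Proof.
move=> n_gt1 ox; subst n; rewrite -im_Zpm => /morphimP[i _ _ ->].
by rewrite im_Zpm sum_gdist_cycle //; exact: leq_bigmax.
Qed.

(** * Distances when all elements outside a subgroup are involutions *)

(** The only powers of y are 1 and y, and y is a power of no other element:
    powers of an element of H stay in H, and another element outside H has
    only 1 and itself as powers. *)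
Lemma gdist_outside (gT : finGroupType) (H : {group gT}) (x y : gT) :
    (forall z, z \notin H -> <[z]>%g = [set 1; z]%g) -> y \notin H ->
  gdist (power_graph gT) x y
    = if x == y then 0%N else if x == 1%g then 1%N else 2%N.
Proof.
move=> invH nHy; rewrite gdist_power_graph; case: ifPn => // xy.
rewrite /power_graph xy (invH y) // !inE (negPf xy) orbF.
have [//|x1] /= := eqVneq x 1%g; rewrite ifF //.
have [Hx|nHx] := boolP (x \in H).
  have /fintype.subsetP sxH : (<[x]> \subset H)%g by rewrite cycle_subG.
  by apply: contraNF nHy; exact: sxH.
rewrite invH // !inE eq_sym [y == x]eq_sym (negPf xy) orbF.
by apply: contraNF nHy => /eqP <-; exact: group1.
Qed.

(** Stated additively because the sum, 2 |A| - 2 + m, would otherwise involve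
    truncated subtraction; m is 1 for distances to the identity and 0 for
    distances to a vertex of A itself. *)
Lemma sum_if_eq (T : finType) (A : {set T}) (a : T) (m : nat) : a \in A ->
  ((\sum_(x in A) (if x == a then m else 2)) + 2 = 2 * #|A| + m)%N.
Proof.
move=> Aa; rewrite (bigD1 a) //= eqxx (eq_bigr (fun=> 2%N)); last first.
  by move=> x /andP[_ /negPf->].
rewrite sum_nat_const (cardD1 a A) Aa.
rewrite (eq_card (B := [predD1 A & a])); last by move=> x; rewrite !inE andbC.
by rewrite /= add1n; move: #|_| => k; lia.
Qed.

Section RowSums.
Variables (gT : finGroupType) (H : {group gT}).
Hypothesis invH : forall z, z \notin H -> <[z]>%g = [set 1; z]%g.
Local Notation d := (gdist (power_graph gT)).

Lemma row_in_out x : x \in H ->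
  (\sum_(y in ~: H) d x y = (if x == 1%g then 1 else 2) * #|~: H|)%N.
Proof.
move=> Hx; rewrite mulnC -sum_nat_const; apply: eq_bigr => y; rewrite inE => nHy.
by rewrite (gdist_outside _ invH) // ifF //; apply: contraNF nHy => /eqP <-.
Qed.

Lemma row_out_in x : x \notin H -> ((\sum_(y in H) d x y).+1 = 2 * #|H|)%N.
Proof.
move=> nHx; apply: (@addIn 1); rewrite -(sum_if_eq 1 (group1 H)) -[_.+1]addn1 -addnA.
congr (_ + _)%N; apply: eq_bigr => y Hy.
rewrite (gdist_sym (@power_graph_sym gT)); last exact: power_graph_connected.
rewrite (gdist_outside _ invH) //.
by rewrite ifF //; apply: contraNF nHx => /eqP <-.
Qed.

Lemma row_out_out x : x \notin H -> ((\sum_(y in ~: H) d x y) + 2 = 2 * #|~: H|)%N.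
Proof.
move=> nHx; rewrite -[RHS]addn0 -(@sum_if_eq _ (~: H) x 0) ?inE //; congr (_ + _)%N.
apply: eq_bigr => y; rewrite inE => nHy; rewrite (gdist_outside _ invH) // eq_sym.
suff /negPf-> : x != 1%g by [].
by apply: contraNneq nHx => ->; exact: group1.
Qed.

Definition block (R : realType) (a b : R) (x : gT) := if x \in H then a else b.

Lemma sum_block (R : realType) (a b : R) x :
  \sum_y (d x y)%:R * block a b y
    = (\sum_(y in H) d x y)%:R * a + (\sum_(y in ~: H) d x y)%:R * b.
Proof.
rewrite (bigID (mem H)) /= !natr_sum !mulr_suml; congr (_ + _).
  by apply: eq_bigr => y Hy; rewrite /block Hy.
by apply: eq_big => y; rewrite ?inE // => /negPf nHy; rewrite /block nHy.
Qed.

Lemma sum_distance_matrix (R : realType) (w : gT -> R) i :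
  \sum_j distance_matrix (power_graph gT) R i j * w (enum_val j)
    = \sum_y (d (enum_val i) y)%:R * w y.
Proof.
rewrite [RHS](big_enum_val (A := gT)) /=.
by apply: eq_bigr => j _; rewrite !mxE.
Qed.

Variables (n : nat).
Hypothesis (oH : #|H| = n) (oHC : #|~: H| = n).

Lemma row_out_block (R : realType) (a b : R) x : x \notin H ->
  \sum_y (d x y)%:R * block a b y = (2 * n%:R - 1) * a + (2 * n%:R - 2) * b.
Proof.
move=> nHx; rewrite sum_block; congr (_ * _ + _ * _).
  by rewrite -oH -natrM -(row_out_in nHx) -natr1 addrK.
by rewrite -oHC -natrM -(row_out_out nHx) natrD addrK.
Qed.

(** The block vector (2n, mu - t) is an eigenvector of the matrix with rows
    (t, 2n) and (2n - 1, 2n - 2), which dominates the block row sums. *)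
Lemma spectral_radius_le (R : realType) (t : R) :
  (forall x, x \in H -> (\sum_(y in H) d x y)%:R <= t) ->
  distance_spectral_radius R (power_graph gT)
    <= 2^-1 * (t + (2 * n%:R - 2)
               + Num.sqrt ((t - (2 * n%:R - 2)) ^+ 2 + 4 * (2 * n%:R * (2 * n%:R - 1)))).
Proof.
move=> le_t.
have n1 : 1 <= n%:R :> R by rewrite ler1n -oH; exact: cardG_gt0.
set p := 2 * n%:R * (2 * n%:R - 1).
have p0 : 0 < p by rewrite /p mulr_gt0 //; lra.
have [] := quadratic_root t (2 * n%:R - 2) p0; set mu := 2^-1 * _ => t_mu muE.
have [+ _] := power_graph_spectral_radiusP R gT.
apply: (@eigenvalue_le_weight _ _ _ (block (2 * n%:R) (mu - t) \o enum_val)).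
- by move=> i j; rewrite mxE ler0n.
- by move=> i; rewrite /= /block; case: ifP => _; lra.
move=> i; rewrite /= sum_distance_matrix; set x := enum_val i.
have [Hx|nHx] := boolP (x \in H); last first.
  by rewrite row_out_block // /block (negPf nHx); move: muE; rewrite /p; lra.
rewrite sum_block /block Hx row_in_out // oHC natrM.
(* the middle term is mu * (2n), the first row of the 2 x 2 eigenvalue equation *)
apply: (@le_trans _ _ (t * (2 * n%:R) + 2 * n%:R * (mu - t))); last by lra.
apply: lerD; first by rewrite ler_wpM2r ?le_t //; lra.
rewrite ler_wpM2r ?subr_ge0 ?(ltW t_mu) //.
by rewrite ler_wpM2r ?ler0n // ler_nat; case: ifP.
Qed.

(** The Rayleigh quotient at the block vector (c, mu - t), c = 2n - 1, an
    eigenvector of the symmetric matrix with rows (t, c) and (c, 2n - 2) of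
    block averages. *)
Lemma le_spectral_radius (R : realType) (t : R) :
    (\sum_(x in H) \sum_(y in H) d x y)%N%:R = n%:R * t ->
  2^-1 * (t + (2 * n%:R - 2)
          + Num.sqrt ((t - (2 * n%:R - 2)) ^+ 2 + 4 * (2 * n%:R - 1) ^+ 2))
    <= distance_spectral_radius R (power_graph gT).
Proof.
move=> sumT.
have n1 : 1 <= n%:R :> R by rewrite ler1n -oH; exact: cardG_gt0.
set c : R := 2 * n%:R - 1.
have p0 : 0 < c ^+ 2 by rewrite exprn_gt0 // /c; lra.
have [] := quadratic_root t (2 * n%:R - 2) p0; set mu := 2^-1 * _ => t_mu muE.
set b := mu - t in muE.
have symD : (distance_matrix (power_graph gT) R)^T = distance_matrix (power_graph gT) R.
  apply/matrixP => i j; rewrite !mxE gdist_sym //; first exact: power_graph_sym.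
  exact: power_graph_connected.
have [_ max_rho] := power_graph_spectral_radiusP R gT.
have := @rayleigh_le R _ _ _ (block c b \o enum_val) symD max_rho.
set rho := distance_spectral_radius R _; rewrite /=.
under eq_bigr do rewrite sum_distance_matrix.
rewrite -(big_enum_val (A := gT) (fun x => block c b x * \sum_y (d x y)%:R * block c b y)) /=.
rewrite -(big_enum_val (A := gT) (fun x => block c b x ^+ 2)) /=.
have -> : \sum_(x in gT) block c b x ^+ 2 = n%:R * (c ^+ 2 + b ^+ 2).
  rewrite (bigID (mem H)) /= mulrDr; congr (_ + _).
    rewrite (eq_bigr (fun=> c ^+ 2)) => [|x Hx]; last by rewrite /block Hx.
    by rewrite sumr_const oH mulr_natl.
  rewrite (eq_bigr (fun=> b ^+ 2)) => [|x /negPf nHx]; last by rewrite /block nHx.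
  by rewrite sumr_const -[in RHS]oHC mulr_natl; congr (_ *+ _); apply: eq_card => x; rewrite !inE.
have -> : \sum_(x in gT) block c b x * (\sum_y (d x y)%:R * block c b y)
    = n%:R * (mu * (c ^+ 2 + b ^+ 2)).
  rewrite (bigID (mem H)) /=.
  rewrite (eq_bigr (fun x => c * ((\sum_(y in H) d x y)%:R * c +
     ((if x == 1%g then 1 else 2) * n)%N%:R * b))); last first.
    by move=> x Hx; rewrite sum_block row_in_out // oHC /block Hx.
  rewrite [X in _ + X](eq_bigr (fun=> b * (c * c + (2 * n%:R - 2) * b))); last first.
    by move=> x nHx; rewrite row_out_block // /block (negPf nHx).
  rewrite -mulr_sumr big_split /= -!mulr_suml -!natr_sum -big_distrl /= sumr_const.
  have -> : #|[pred x | x \notin H]| = n.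
    by rewrite -oHC; apply: eq_card => x; rewrite !inE.
  have sum12 : (\sum_(x in H) (if x == 1%g then 1 else 2))%N%:R = c.
    apply: (addIr 2); rewrite -natrD sum_if_eq // oH natrD natrM /c; ring.
  rewrite natrM -[_ *+ n]mulr_natl sum12 sumT.
  have muD : mu = b + t by rewrite /b subrK.
  (* after substituting c^2 = (mu - t)(mu - (2n - 2)) this is an identity *)
  rewrite muD in muE *; have {}muE := esym muE.
  ring: muE.
rewrite mulrCA ler_pM2r // mulr_gt0 //; first by lra.
by rewrite ltr_pwDl // sqr_ge0.
Qed.
End RowSums.

(** * The power graph of a dihedral group *)

(** The presentation gives G = <x><z> with |<x>| <= n and |<z>| <= 2, so
    |G| = 2n forces x to have order n.  An element outside <x> is x^i z, and
    z inverts x^i, so its square is 1. *)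
Lemma dihedral_structure n : (1 < n)%N ->
  exists2 x : 'D_(2 * n), #[x]%g = n
    & forall y, y \notin <[x]>%g -> <[y]>%g = [set 1; y]%g.
Proof.
move=> n_gt1; have oD := @card_dihedral n n_gt1.
have presD := @Grp_dihedral n n_gt1; rewrite -mul2n in oD presD.
have [_ /existsP[[x z]] /= /eqP[defG xn z2 xz]] := isoGrpP _ presD (isog_refl _).
have {}defG : (<[x]> * <[z]>)%g = [set: 'D_(2 * n)].
  by rewrite -norm_joinEr // norms_cycle xz groupV cycle_id.
have := mul_cardG <[x]> <[z]>; rewrite defG oD => oxz.
have I_gt0 : (0 < #|<[x]> :&: <[z]>|%g)%N by exact: cardG_gt0.
have x_le : (#[x]%g <= n)%N by rewrite dvdn_leq ?order_dvdn ?xn //; exact: ltnW.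
have z_le : (#[z]%g <= 2)%N by rewrite dvdn_leq ?order_dvdn ?z2.
rewrite /= -!orderE in oxz.
exists x.
  apply/eqP; rewrite eqn_leq x_le -(leq_pmul2l (m := 2)) //.
  apply: (@leq_trans (#[x]%g * #[z]%g)%N); first by rewrite oxz leq_pmulr.
  by rewrite mulnC leq_mul.
move=> y nxy; apply: cycle2g.
have : y \in [set: 'D_(2 * n)]%g by rewrite inE.
rewrite -defG => /mulsgP[_ _ /cycleP[i ->] /cycleP[j ->] yE].
have zz : (z * z = 1)%g by rewrite -z2.
have {}yE : y = (x ^+ i * z)%g.
  move: nxy; rewrite {}yE -(odd_double_half j) expgD -mul2n expgM z2 expg1n mulg1.
  by case: (odd j); rewrite ?expg1 // expg0 mulg1 mem_cycle.
apply: nt_prime_order => //; last by apply: contraNneq nxy => ->; exact: group1.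
have zV : (z^-1 = z)%g by apply/eqP; rewrite eq_invg_mul zz.
have : ((x ^+ i) ^ z = x ^- i)%g by rewrite conjXg xz expgVn.
by rewrite conjgE zV yE expgS expg1 -!mulgA => ->; rewrite mulgV.
Qed.

Theorem theorem3p2 (R : realType) (n : nat) (n_ge3 : (3 <= n)%N) :
  let rho1 : R := distance_spectral_radius R (power_graph 'D_(2 * n)) in
  let Tavg : R := avg_transmission (power_graph 'Z_n) R in
  let Tmax : R := (max_transmission (power_graph 'Z_n))%:R in
  let N : R := n%:R in
  2^-1 * ((Tavg + 2 * N - 2)
          + Num.sqrt ((Tavg - 2 * N + 2) ^+ 2 + 4 * (2 * N - 1) ^+ 2)) <= rho1
  /\
  rho1 <= 2^-1 * ((Tmax + 2 * N - 2)
          + Num.sqrt ((Tmax - 2 * N + 2) ^+ 2 + 8 * N * (2 * N - 1))).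
Proof.
move=> rho1 Tavg Tmax N.
have n_gt1 : (1 < n)%N by exact: ltnW.
have [x ox inv] := dihedral_structure n_gt1.
have oH : #|<[x]>%g| = n by [].
have oHC : #|~: <[x]>%g| = n.
  apply/eqP; rewrite -(eqn_add2l n) -[X in (X + _)%N == _]oH cardsC -cardsT.
  by rewrite addnn -(card_dihedral n_gt1) -mul2n.
have dE (t : R) : t - (2 * N - 2) = t - 2 * N + 2 by ring.
split.
  have := le_spectral_radius inv oH oHC (avg_transmission_cycle R n_gt1 ox).
  by rewrite -/N -/Tavg dE addrA.
have := @spectral_radius_le _ _ inv n oH oHC R Tmax.
rewrite -/N dE addrA.
have -> : 4 * (2 * N * (2 * N - 1)) = 8 * N * (2 * N - 1) by ring.
by apply=> y Hy; rewrite ler_nat; exact: le_max_transmission_cycle.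
Qed.
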